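(* Let $\omega(x,y,z) = x(y\circ z) + z(x\circ y) + (z\circ x)y$ with $u\circ v=\tfrac12(uv+vu)$ (the Jordan family, $q=\tfrac12$), and let $\omega'(x,y,z) = xyz+zyx$ (the Jordan family, $q=\infty$). Then $U(A^\omega)\cong U(A^{\omega'})$ as unital associative algebras.
   Context: $\mathbb{F}$ is a field of characteristic $0$. $A$ is the 2-dimensional space of $2\times 2$ matrices over $\mathbb{F}$ with zero diagonal, with basis $e_1 = \begin{bmatrix} 0&1\\0&0\end{bmatrix}$, $e_2 = \begin{bmatrix} 0&0\\1&0\end{bmatrix}$; it is closed under triple products $xyz$ of matrices. For a trilinear operation $\omega(x,y,z)$ (a fixed rational linear combination of the six products of $x,y,z$ in all orders), $A^\omega$ denotes the space $A$ with the trilinear operation $\omega$ computed using matrix multiplication. Let $\mathbb{F}\langle a,b\rangle$ be the free unital associative algebra and $\phi\colon A \to \mathbb{F}\langle a,b\rangle$ the linear map with $\phi(e_1)=a$, $\phi(e_2)=b$. The universal associative envelope is $U(A^\omega) = \mathbb{F}\langle a,b\rangle / I$, where $I$ is the two-sided ideal generated by the elements $\omega(\phi(x),\phi(y),\phi(z)) - \phi(\omega(x,y,z))$ for $x,y,z\in\{e_1,e_2\}$. *)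

(* Defs.v *)
From HB Require Import structures.
From mathcomp Require Import all_boot all_order all_algebra finmap.
From mathcomp.multinomials Require Import monalg.
From mathcomp Require Import boolp.

Set Implicit Arguments.
Unset Strict Implicit.
Unset Printing Implicit Defensive.

Import GRing.Theory.
Local Open Scope ring_scope.

Section TwoSidedIdeal.
Variables (R : nzRingType) (G : R -> Prop).

Inductive two_sided_ideal : R -> Prop :=
| TsiGen g : G g -> two_sided_ideal g
| Tsi0 : two_sided_ideal 0
| TsiB x y : two_sided_ideal x -> two_sided_ideal y -> two_sided_ideal (x - y)
| TsiMl r x : two_sided_ideal x -> two_sided_ideal (r * x)
| TsiMr x r : two_sided_ideal x -> two_sided_ideal (x * r).

Definition tsi_pred (x : R) : bool := `[< two_sided_ideal x >].

Fact tsi_zmod_closed : zmod_closed tsi_pred.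
Proof.
split; first by apply/asboolP; exact: Tsi0.
by move=> x y /asboolP Ix /asboolP Iy; apply/asboolP; exact: TsiB.
Qed.

HB.instance Definition _ := GRing.isZmodClosed.Build R tsi_pred tsi_zmod_closed.

Definition tsi : zmodClosed R := GRing.ZmodClosed.clone R tsi_pred _.

End TwoSidedIdeal.

Section QuotientAlgebra.
Variables (F : fieldType) (B : algType F) (G : B -> Prop).

(* MathComp algebras satisfy 1 != 0, hence the (phantom) properness argument. *)
Definition quot_alg (proper : ~ two_sided_ideal G 1) : Type :=
  Quotient.quot (tsi G).

Variable proper : ~ two_sided_ideal G 1.
Local Notation Q := (quot_alg proper).

HB.instance Definition _ := GRing.Zmodule.on Q.
HB.instance Definition _ : EqQuotient B (Quotient.equiv (tsi G)) Q :=
  EqQuotient.on Q.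
HB.instance Definition _ := ZmodQuotient.on Q.

Local Open Scope quotient_scope.

Lemma quot_algP (x y : B) :
  reflect (two_sided_ideal G (x - y)) (x == y %[mod Q]).
Proof.
apply: (iffP idP) => [|H].
  by rewrite -Quotient.idealrBE => /asboolP.
by rewrite -Quotient.idealrBE; apply/asboolP.
Qed.

Definition quot_one : Q := lift_cst Q 1.
Definition quot_mul : Q -> Q -> Q := lift_op2 Q *%R.
Definition quot_scale (c : F) : Q -> Q := lift_op1 Q ( *:%R c).

Canonical pi_quot_one_morph := PiConst quot_one.

Fact pi_quot_mul : {morph \pi_Q : x y / x * y >-> quot_mul x y}.
Proof.
move=> x y; unlock quot_mul; apply/eqP/quot_algP.
have reprI z : two_sided_ideal G (z - repr (\pi_Q z)).
  by apply/quot_algP; rewrite reprK.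
set x' := repr _; set y' := repr _.
have -> : x * y - x' * y' = (x - x') * y - x' * (y' - y).
  by rewrite mulrBl mulrBr opprB addrA subrK.
apply: TsiB; first exact/TsiMr/reprI.
by apply: TsiMl; rewrite -opprB -[- _]add0r; apply: TsiB (Tsi0 _) (reprI y).
Qed.
Canonical pi_quot_mul_morph := PiMorph2 pi_quot_mul.

Fact pi_quot_scale c : {morph \pi_Q : x / c *: x >-> quot_scale c x}.
Proof.
move=> x; unlock quot_scale; apply/eqP/quot_algP.
rewrite -scalerBr -mulr_algl; apply: TsiMl.
by apply/quot_algP; rewrite reprK.
Qed.
Canonical pi_quot_scale_morph c := PiMorph1 (pi_quot_scale c).

Fact quot_mulA : associative quot_mul.
Proof.
elim/quotW=> x; elim/quotW=> y; elim/quotW=> z.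
by rewrite !piE mulrA.
Qed.
Fact quot_mul1 : left_id quot_one quot_mul.
Proof. by elim/quotW=> x; rewrite !piE mul1r. Qed.
Fact quot_mulr1 : right_id quot_one quot_mul.
Proof. by elim/quotW=> x; rewrite !piE mulr1. Qed.
Fact quot_mulDl : left_distributive quot_mul +%R.
Proof.
elim/quotW=> x; elim/quotW=> y; elim/quotW=> z.
by rewrite !piE mulrDl.
Qed.
Fact quot_mulDr : right_distributive quot_mul +%R.
Proof.
elim/quotW=> x; elim/quotW=> y; elim/quotW=> z.
by rewrite !piE mulrDr.
Qed.
Fact quot_one_neq0 : quot_one != 0.
Proof.
apply/eqP => one0; apply: proper; rewrite -[1]subr0; apply/quot_algP/eqP.
by rewrite !pi_zeror -one0; unlock quot_one.
Qed.

HB.instance Definition _ := GRing.Zmodule_isNzRing.Build Q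
  quot_mulA quot_mul1 quot_mulr1 quot_mulDl quot_mulDr quot_one_neq0.

Fact quot_scaleA a b (v : Q) :
  quot_scale a (quot_scale b v) = quot_scale (a * b) v.
Proof. by elim/quotW: v => x; rewrite !piE scalerA. Qed.
Fact quot_scale1 : left_id 1 quot_scale.
Proof. by elim/quotW=> x; rewrite !piE scale1r. Qed.
Fact quot_scaleDr : right_distributive quot_scale +%R.
Proof. by move=> c; elim/quotW=> x; elim/quotW=> y; rewrite !piE scalerDr. Qed.
Fact quot_scaleDl (v : Q) : {morph quot_scale^~ v : a b / a + b}.
Proof. by elim/quotW: v => x a b /=; rewrite !piE scalerDl. Qed.

HB.instance Definition _ := GRing.Zmodule_isLmodule.Build F Q
  quot_scaleA quot_scale1 quot_scaleDr quot_scaleDl.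

Fact quot_scaleAl (c : F) (x y : Q) : c *: (x * y) = (c *: x) * y.
Proof.
elim/quotW: x => x; elim/quotW: y => y.
by rewrite /GRing.scale /GRing.mul /= !piE scalerAl.
Qed.
HB.instance Definition _ := GRing.Lmodule_isLalgebra.Build F Q quot_scaleAl.

Fact quot_scaleAr (c : F) (x y : Q) : c *: (x * y) = x * (c *: y).
Proof.
elim/quotW: x => x; elim/quotW: y => y.
by rewrite /GRing.scale /GRing.mul /= !piE scalerAr.
Qed.
HB.instance Definition _ := GRing.Lalgebra_isAlgebra.Build F Q quot_scaleAr.

Lemma quot_pi1 : \pi_Q 1 = 1 :> Q.
Proof. by rewrite {2}/GRing.one /= [RHS]piE. Qed.
Lemma quot_piM (x y : B) : \pi_Q (x * y) = \pi_Q x * \pi_Q y.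
Proof. exact: pi_quot_mul. Qed.
Lemma quot_piZ (c : F) (x : B) : \pi_Q (c *: x) = c *: \pi_Q x.
Proof. exact: pi_quot_scale. Qed.

End QuotientAlgebra.

(* This is the monoid algebra of the free monoid on 'I_2.  Its operations are
   those of {malg _}, locked because unification otherwise unfolds the finitely
   supported functions that implement them. *)
Definition free_alg (F : fieldType) : Type := {malg F[{fmonom 'I_2}]}.

HB.lock Definition free_add (F : fieldType) (x y : free_alg F) : free_alg F :=
  (x : {malg F[{fmonom 'I_2}]}) + y.
HB.lock Definition free_opp (F : fieldType) (x : free_alg F) : free_alg F :=
  - (x : {malg F[{fmonom 'I_2}]}).
HB.lock Definition free_zero (F : fieldType) : free_alg F :=
  (0 : {malg F[{fmonom 'I_2}]}).
HB.lock Definition free_mul (F : fieldType) (x y : free_alg F) : free_alg F :=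
  (x : {malg F[{fmonom 'I_2}]}) * y.
HB.lock Definition free_one (F : fieldType) : free_alg F :=
  (1 : {malg F[{fmonom 'I_2}]}).
HB.lock Definition free_scale (F : fieldType) (c : F) (x : free_alg F) :
  free_alg F := c *: (x : {malg F[{fmonom 'I_2}]}).
HB.lock Definition gen_a (F : fieldType) : free_alg F := << fmu (0 : 'I_2) >>.
HB.lock Definition gen_b (F : fieldType) : free_alg F := << fmu (1 : 'I_2) >>.

Section FreeAlgebra.
Variable F : fieldType.
Local Notation freeE :=
  (free_add.unlock, free_opp.unlock, free_zero.unlock, free_mul.unlock,
   free_one.unlock, free_scale.unlock).

HB.instance Definition _ := Choice.on (free_alg F).

Fact free_addA : associative (@free_add F).
Proof. by move=> x y z; rewrite !freeE addrA. Qed.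
Fact free_addC : commutative (@free_add F).
Proof. by move=> x y; rewrite !freeE addrC. Qed.
Fact free_add0 : left_id (free_zero F) (@free_add F).
Proof. by move=> x; rewrite !freeE add0r. Qed.
Fact free_addN : left_inverse (free_zero F) (@free_opp F) (@free_add F).
Proof. by move=> x; rewrite !freeE addNr. Qed.
HB.instance Definition _ := GRing.isZmodule.Build (free_alg F)
  free_addA free_addC free_add0 free_addN.

Fact free_mulA : associative (@free_mul F).
Proof. by move=> x y z; rewrite !freeE mulrA. Qed.
Fact free_mul1 : left_id (free_one F) (@free_mul F).
Proof. by move=> x; rewrite !freeE mul1r. Qed.
Fact free_mulr1 : right_id (free_one F) (@free_mul F).
Proof. by move=> x; rewrite !freeE mulr1. Qed.
Fact free_mulDl : left_distributive (@free_mul F) (@free_add F).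
Proof. by move=> x y z; rewrite !freeE mulrDl. Qed.
Fact free_mulDr : right_distributive (@free_mul F) (@free_add F).
Proof. by move=> x y z; rewrite !freeE mulrDr. Qed.
Fact free_one_neq0 : free_one F != free_zero F.
Proof. by rewrite !freeE; apply: oner_neq0. Qed.
HB.instance Definition _ := GRing.Zmodule_isNzRing.Build (free_alg F)
  free_mulA free_mul1 free_mulr1 free_mulDl free_mulDr free_one_neq0.

Fact free_scaleA c d (x : free_alg F) :
  free_scale c (free_scale d x) = free_scale (c * d) x.
Proof. by rewrite !freeE scalerA. Qed.
Fact free_scale1 : left_id 1 (@free_scale F).
Proof. by move=> x; rewrite !freeE scale1r. Qed.
Fact free_scaleDr : right_distributive (@free_scale F) (@free_add F).
Proof. by move=> c x y; rewrite !freeE scalerDr. Qed.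
Fact free_scaleDl (x : free_alg F) :
  {morph (@free_scale F)^~ x : c d / c + d >-> free_add c d}.
Proof. by move=> c d /=; rewrite !freeE scalerDl. Qed.
HB.instance Definition _ := GRing.Zmodule_isLmodule.Build F (free_alg F)
  free_scaleA free_scale1 free_scaleDr free_scaleDl.

Fact free_scaleAl (c : F) (x y : free_alg F) : c *: (x * y) = (c *: x) * y.
Proof.
rewrite /GRing.scale /GRing.mul /= !freeE.
exact: (@scalerAl F {malg F[{fmonom 'I_2}]}).
Qed.
HB.instance Definition _ :=
  GRing.Lmodule_isLalgebra.Build F (free_alg F) free_scaleAl.

Fact free_scaleAr (c : F) (x y : free_alg F) : c *: (x * y) = x * (c *: y).
Proof.
rewrite /GRing.scale /GRing.mul /= !freeE.
rewrite malgZ_def; apply/malgP => k; rewrite fgscaleE.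
rewrite [LHS](congr1 _ (mcoeffMl x y k)) mulr_sumr.
rewrite [RHS](mcoeffMlw k (fsubset_refl _) (msuppZ_le c y)).
apply: eq_bigr => k1 _; rewrite mulr_sumr; apply: eq_bigr => k2 _.
by rewrite (mcoeffZ c y k2) mulrnAr mulrCA.
Qed.
HB.instance Definition _ :=
  GRing.Lalgebra_isAlgebra.Build F (free_alg F) free_scaleAr.

Variables (B : algType F) (u v : B).

Definition free_monom_eval (m : {fmonom 'I_2}) : B :=
  \prod_(i <- (m : seq 'I_2)) (if i == 0 then u else v).

Fact free_monom_eval_morphism : mmorphism free_monom_eval.
Proof.
split=> [m1 m2|]; rewrite /free_monom_eval.
  by rewrite fmM big_cat.
by rewrite fm1 big_nil.
Qed.
HB.instance Definition _ :=
  isMultiplicative.Build _ _ free_monom_eval free_monom_eval_morphism.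

Definition free_eval : free_alg F -> B := mmap (in_alg B) free_monom_eval.

Fact free_eval_zmod_morphism : zmod_morphism free_eval.
Proof.
move=> x y; rewrite {1}/GRing.add {1}/GRing.opp /= !freeE.
exact: (raddfB (mmap (in_alg B) free_monom_eval)).
Qed.
HB.instance Definition _ :=
  GRing.isZmodMorphism.Build (free_alg F) B free_eval free_eval_zmod_morphism.

Fact free_eval_monoid_morphism : monoid_morphism free_eval.
Proof.
have comm (g : {malg F[{fmonom 'I_2}]}) m m' :
    GRing.comm (in_alg B g@_m) (free_monom_eval m').
  by rewrite /GRing.comm /= mulr_algl mulr_algr.
have [fM f1] := commr_mmap_is_multiplicative comm.
split; first by rewrite /GRing.one /= free_one.unlock.
by move=> x y; rewrite {1}/GRing.mul /= free_mul.unlock.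
Qed.
HB.instance Definition _ := GRing.isMonoidMorphism.Build (free_alg F) B free_eval
  free_eval_monoid_morphism.

Fact free_eval_scalable : scalable free_eval.
Proof.
move=> c x; rewrite {1}/GRing.scale /= free_scale.unlock.
by rewrite /free_eval mmapZ /= mulr_algl.
Qed.
HB.instance Definition _ :=
  GRing.isScalable.Build F (free_alg F) B *:%R free_eval free_eval_scalable.

Lemma free_eval_a : free_eval (gen_a F) = u.
Proof.
by rewrite /free_eval unlock mmapU /= scale1r mul1r /free_monom_eval fmU big_seq1.
Qed.
Lemma free_eval_b : free_eval (gen_b F) = v.
Proof.
by rewrite /free_eval unlock mmapU /= scale1r mul1r /free_monom_eval fmU big_seq1.
Qed.

End FreeAlgebra.

Section TrilinearOperations.
Variable F : fieldType.

(* A trilinear operation makes sense in every associative F-algebra; triopP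
   says that it is one fixed rational combination of the six products. *)
Record trilinear_op := TrilinearOp {
  triop :> forall B : algType F, B -> B -> B -> B;
  triopP : exists c1 c2 c3 c4 c5 c6 : rat,
    forall (B : algType F) (x y z : B),
      triop x y z = ratr c1 *: (x * y * z) + ratr c2 *: (x * z * y)
                  + ratr c3 *: (y * x * z) + ratr c4 *: (y * z * x)
                  + ratr c5 *: (z * x * y) + ratr c6 *: (z * y * x)
}.

Definition jordan_prod (B : algType F) (u v : B) : B :=
  2%:R^-1 *: (u * v + v * u).

Definition jordan_half_fun (B : algType F) (x y z : B) : B :=
  x * jordan_prod y z + z * jordan_prod x y + jordan_prod z x * y.

Definition jordan_infty_fun (B : algType F) (x y z : B) : B :=
  x * y * z + z * y * x.

Fact ratr_half : ratr 2%:R^-1 = 2%:R^-1 :> F.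
Proof.
have -> : 2%:R^-1 = [rat 1 // 2] by apply/eqP.
by rewrite /ratr (_ : numq _ = 1) // (_ : denq _ = 2) // div1r.
Qed.

Fact jordan_halfP : exists c1 c2 c3 c4 c5 c6 : rat,
  forall (B : algType F) (x y z : B),
    jordan_half_fun x y z = ratr c1 *: (x * y * z) + ratr c2 *: (x * z * y)
                          + ratr c3 *: (y * x * z) + ratr c4 *: (y * z * x)
                          + ratr c5 *: (z * x * y) + ratr c6 *: (z * y * x).
Proof.
pose h : rat := 2%:R^-1.
have r0 : ratr 0 = 0 :> F by exact: (ratr_nat F 0).
have r1 : ratr 1 = 1 :> F by exact: (ratr_nat F 1).
have expand (B : algType F) (x y z : B) : jordan_half_fun x y z =
    2%:R^-1 *: (x * y * z + z * y * x) +
    (2%:R^-1 + 2%:R^-1) *: (x * z * y + z * x * y).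
  rewrite /jordan_half_fun /jordan_prod -!scalerAr -!scalerAl scalerDl.
  rewrite -!scalerDr !mulrDl !mulrDr !mulrA; congr (_ *: _).
  rewrite -!addrA; congr (_ + _); rewrite [RHS]addrCA; congr (_ + _).
  by rewrite addrCA; congr (_ + _); rewrite addrC addrA.
have [two0|two_neq0] := eqVneq (2%:R : F) 0.
  (* degenerate case: in characteristic 2, 2^-1 is 0 by convention *)
  exists 0, 0, 0, 0, 0, 0 => B x y z.
  by rewrite expand r0 two0 invr0 addr0 !scale0r !addr0.
exists h, 1, 0, 0, 1, h => B x y z; rewrite expand r0 r1 ratr_half.
have -> : 2%:R^-1 + 2%:R^-1 = 1 :> F.
  by rewrite -mulr2n -[LHS]mulr_natl mulfV.
by rewrite !scale0r !addr0 !scale1r scalerDr -!addrA; congr (_ + _);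
  rewrite addrC -!addrA.
Qed.

Fact jordan_inftyP : exists c1 c2 c3 c4 c5 c6 : rat,
  forall (B : algType F) (x y z : B),
    jordan_infty_fun x y z = ratr c1 *: (x * y * z) + ratr c2 *: (x * z * y)
                           + ratr c3 *: (y * x * z) + ratr c4 *: (y * z * x)
                           + ratr c5 *: (z * x * y) + ratr c6 *: (z * y * x).
Proof.
exists 1, 0, 0, 0, 0, 1 => B x y z.
have r0 : ratr 0 = 0 :> F by exact: (ratr_nat F 0).
have r1 : ratr 1 = 1 :> F by exact: (ratr_nat F 1).
by rewrite r0 r1 !scale0r !scale1r !addr0.
Qed.

Definition jordan_half := TrilinearOp jordan_halfP.
Definition jordan_infty := TrilinearOp jordan_inftyP.

Lemma triop_morph (omega : trilinear_op) (B C : algType F)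
    (f : {lrmorphism B -> C}) (x y z : B) :
  f (omega B x y z) = omega C (f x) (f y) (f z).
Proof.
have [c1 [c2 [c3 [c4 [c5 [c6 E]]]]]] := triopP omega.
by rewrite !E !raddfD /= !linearZ /= !rmorphM.
Qed.

End TrilinearOperations.

Section ZeroDiagonal.
Variable F : fieldType.

Definition zero_diag : pred 'M[F]_2 := fun M => [forall i, M i i == 0].

Fact zero_diag_submod_closed : submod_closed zero_diag.
Proof.
split=> [|c M N /forallP M0 /forallP N0]; apply/forallP => i.
  by rewrite mxE.
by rewrite !mxE (eqP (M0 i)) (eqP (N0 i)) mulr0 addr0.
Qed.
HB.instance Definition _ :=
  GRing.isSubmodClosed.Build F 'M[F]_2 zero_diag zero_diag_submod_closed.

Record zdmx := Zdmx { zdmx_val :> 'M[F]_2; zdmxP : zero_diag zdmx_val }.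

HB.instance Definition _ := [isSub for zdmx_val].
HB.instance Definition _ := [Choice of zdmx by <:].
HB.instance Definition _ := [SubChoice_isSubLmodule of zdmx by <:].

Fact zero_diag_delta (i j : 'I_2) : i != j -> zero_diag (delta_mx i j).
Proof.
move=> ij; apply/forallP => k; rewrite mxE.
by have [->|//] := eqVneq k i; rewrite (negbTE ij).
Qed.

Definition zd_e1 : zdmx := Zdmx (@zero_diag_delta 0 1 isT).
Definition zd_e2 : zdmx := Zdmx (@zero_diag_delta 1 0 isT).

Section TripleOp.
Variable omega : trilinear_op F.

Fact zero_diag_mul3 (M N P : 'M[F]_2) :
  zero_diag M -> zero_diag N -> zero_diag P -> zero_diag (M * N * P).
Proof.
move=> /forallP M0 /forallP N0 /forallP P0; apply/forallP => i.
rewrite mxE big1 ?eqxx // => j _; rewrite mxE big_distrl big1 //= => k _.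
have [->|ik] := eqVneq k i; first by rewrite (eqP (M0 i)) !mul0r.
have [->|kj] := eqVneq k j; first by rewrite (eqP (N0 j)) mulr0 mul0r.
suff -> : j = i by rewrite (eqP (P0 i)) mulr0.
apply/val_inj; move: ik kj; rewrite -!val_eqE.
by case: i j k {M0 N0 P0} => [[|[|//]] ?] [[|[|//]] ?] [[|[|//]] ?].
Qed.

Fact zero_diag_triop (M N P : 'M[F]_2) :
  zero_diag M -> zero_diag N -> zero_diag P -> zero_diag (omega _ M N P).
Proof.
move=> M0 N0 P0; have [c1 [c2 [c3 [c4 [c5 [c6 ->]]]]]] := triopP omega.
have zdD X Y : zero_diag X -> zero_diag Y -> zero_diag (X + Y).
  move=> /forallP X0 /forallP Y0; apply/forallP => i.
  by rewrite mxE (eqP (X0 i)) (eqP (Y0 i)) addr0.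
have zdZ c X Y Z : zero_diag X -> zero_diag Y -> zero_diag Z ->
    zero_diag (c *: (X * Y * Z)).
  move=> X0 Y0 Z0; have /forallP XYZ0 := zero_diag_mul3 X0 Y0 Z0.
  by apply/forallP => i; rewrite mxE (eqP (XYZ0 i)) mulr0.
by do 5![apply: (zdD); last by apply: zdZ]; apply: zdZ.
Qed.

Definition zd_triop (x y z : zdmx) : zdmx :=
  Zdmx (zero_diag_triop (zdmxP x) (zdmxP y) (zdmxP z)).

End TripleOp.

Definition zd_phi (x : zdmx) : free_alg F :=
  (x : 'M_2) 0 1 *: gen_a F + (x : 'M_2) 1 0 *: gen_b F.

Fact zd_phi_linear : linear zd_phi.
Proof.
move=> c x y; rewrite /zd_phi !mxE !scalerDl -!scalerA scalerDr.
by rewrite addrACA.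
Qed.
HB.instance Definition _ :=
  GRing.isLinear.Build F zdmx (free_alg F) *:%R zd_phi zd_phi_linear.

Lemma zd_phi_e1 : zd_phi zd_e1 = gen_a F.
Proof. by rewrite /zd_phi !mxE /= scale1r scale0r addr0. Qed.

Lemma zd_phi_e2 : zd_phi zd_e2 = gen_b F.
Proof. by rewrite /zd_phi !mxE /= scale1r scale0r add0r. Qed.

End ZeroDiagonal.

Section Envelope.
Variables (F : fieldType) (omega : trilinear_op F).

Definition envelope_rel (r : free_alg F) : Prop :=
  exists x y z : zdmx F,
    [/\ x \in [:: zd_e1 F; zd_e2 F], y \in [:: zd_e1 F; zd_e2 F],
        z \in [:: zd_e1 F; zd_e2 F] &
        r = omega _ (zd_phi x) (zd_phi y) (zd_phi z)
            - zd_phi (zd_triop omega x y z)].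

Fact zd_rep_phi (x : zdmx F) :
  free_eval (zd_e1 F : 'M_2) (zd_e2 F : 'M_2) (zd_phi x) = x.
Proof.
rewrite /zd_phi raddfD /= !linearZ /= free_eval_a free_eval_b.
have ord2 (k : 'I_2) : k = 0 \/ k = 1.
  by case: k => [[|[|//]] ?]; [left|right]; apply: val_inj.
have /forallP x0 := zdmxP x; have := x0 0; have := x0 1 => /eqP x1 /eqP x2.
apply/matrixP => i j; rewrite !mxE.
by case: (ord2 i) (ord2 j) => -> [] ->;
  rewrite /= ?mulr0 ?mulr1 ?addr0 ?add0r ?x1 ?x2.
Qed.

Fact envelope_proper : ~ two_sided_ideal envelope_rel 1.
Proof.
pose f : {lrmorphism free_alg F -> 'M[F]_2} :=
  free_eval (zd_e1 F : 'M_2) (zd_e2 F : 'M_2).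
have f0 r : two_sided_ideal envelope_rel r -> f r = 0.
  elim=> [g [x [y [z [_ _ _ ->]]]]||u v _ fu _ fv|u v _ fv|v u _ fv].
  - by rewrite raddfB /= (triop_morph omega f) /= !zd_rep_phi subrr.
  - exact: raddf0.
  - by rewrite raddfB /= fu fv subrr.
  - by rewrite rmorphM /= fv mulr0.
  - by rewrite rmorphM /= fv mul0r.
by move=> /f0 /eqP; rewrite rmorph1 oner_eq0.
Qed.

Definition envelope : algType F := quot_alg envelope_proper.

End Envelope.

(* Main.v *)
(* Both envelopes are the algebra presented by [a^2 = b^2 = 0], [aba = a],
   [bab = b]: these relations make [e_1 |-> a], [e_2 |-> b] preserve triple
   products, hence every trilinear operation, and conversely each Jordan
   operation forces them.  For [q = oo] the relations give [a^3 = 0],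
   [aba = a] and [a^2 b + b a^2 = 0]; right multiplication of the last by [a]
   yields [a^2 = 0].  For [q = 1/2] they give [a^3 = 0], [aba + 2 a^2 b = a]
   and [a^2 b + 3 b a^2 + 2 aba = 2a]; multiplying the second by [a] on either
   side and the third by [a] on the right yields [3 a^2 = 0]. *)

From HB Require Import structures.
Require Import Defs.
From mathcomp Require Import all_boot all_order all_algebra.

Set Implicit Arguments.
Unset Strict Implicit.
Unset Printing Implicit Defensive.

Import GRing.Theory.
Local Open Scope ring_scope.

(** * Universal property of the quotient algebra *)

Section QuotientLift.
Variables (F : fieldType) (B : algType F) (G : B -> Prop).
Variable proper : ~ two_sided_ideal G 1.
Local Notation Q := (quot_alg proper).
Local Open Scope quotient_scope.

Definition quot_proj (x : B) : Q := \pi_Q x.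

Fact quot_proj_zmod_morphism : zmod_morphism quot_proj.
Proof. by move=> x y; rewrite /quot_proj !piE. Qed.
HB.instance Definition _ :=
  GRing.isZmodMorphism.Build B Q quot_proj quot_proj_zmod_morphism.

Fact quot_proj_monoid_morphism : monoid_morphism quot_proj.
Proof. by split=> [|x y]; [exact: quot_pi1 | exact: quot_piM]. Qed.
HB.instance Definition _ :=
  GRing.isMonoidMorphism.Build B Q quot_proj quot_proj_monoid_morphism.

Fact quot_proj_scalable : scalable quot_proj.
Proof. by move=> c x; exact: quot_piZ. Qed.
HB.instance Definition _ :=
  GRing.isScalable.Build F B Q *:%R quot_proj quot_proj_scalable.

Lemma quot_proj_eq0 (x : B) : two_sided_ideal G x -> quot_proj x = 0.
Proof.
move=> Gx; rewrite -(raddf0 quot_proj); apply/eqP/quot_algP.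
by rewrite subr0.
Qed.

Lemma quot_projW (P : Q -> Prop) : (forall x, P (quot_proj x)) -> forall q, P q.
Proof. by move=> Pp; elim/quotW. Qed.

Lemma two_sided_ideal_ker (C : algType F) (f : {lrmorphism B -> C}) :
  (forall g, G g -> f g = 0) -> forall x, two_sided_ideal G x -> f x = 0.
Proof.
move=> fG x; elim=> [//||u v _ fu _ fv|u v _ fv|v u _ fv].
- exact: raddf0.
- by rewrite raddfB /= fu fv subrr.
- by rewrite rmorphM /= fv mulr0.
- by rewrite rmorphM /= fv mul0r.
Qed.

Variables (C : algType F) (f : {lrmorphism B -> C}).
Hypothesis fG : forall g, G g -> f g = 0.

(* The phantom argument lets canonical structure inference recover [fG]. *)
Definition quot_lift of (forall g, G g -> f g = 0) : Q -> C :=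
  fun q => f (repr q).
Local Notation lift := (quot_lift fG).

Lemma quot_lift_proj (x : B) : lift (quot_proj x) = f x.
Proof.
apply/subr0_eq; rewrite -raddfB; apply: (two_sided_ideal_ker fG).
by apply/(quot_algP proper); rewrite reprK.
Qed.

Fact quot_lift_zmod_morphism : zmod_morphism lift.
Proof.
elim/quot_projW=> x; elim/quot_projW=> y.
by rewrite -raddfB !quot_lift_proj raddfB.
Qed.
HB.instance Definition _ :=
  GRing.isZmodMorphism.Build Q C lift quot_lift_zmod_morphism.

Fact quot_lift_monoid_morphism : monoid_morphism lift.
Proof.
split; first by rewrite -(rmorph1 quot_proj) quot_lift_proj rmorph1.
elim/quot_projW=> x; elim/quot_projW=> y.
by rewrite -rmorphM !quot_lift_proj rmorphM.
Qed.
HB.instance Definition _ :=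
  GRing.isMonoidMorphism.Build Q C lift quot_lift_monoid_morphism.

Fact quot_lift_scalable : scalable lift.
Proof.
by move=> c; elim/quot_projW=> x; rewrite -linearZ !quot_lift_proj linearZ.
Qed.
HB.instance Definition _ :=
  GRing.isScalable.Build F Q C *:%R lift quot_lift_scalable.

End QuotientLift.

(** The universal property gives a morphism in each direction. Both send the class of [x] to the
    class of [x], so they are mutually inverse. *)
Lemma quot_alg_iso (F : fieldType) (B : algType F) (G H : B -> Prop)
    (pG : ~ two_sided_ideal G 1) (pH : ~ two_sided_ideal H 1) :
    (forall g, G g -> quot_proj pH g = 0) ->
    (forall h, H h -> quot_proj pG h = 0) ->
  exists f : {lrmorphism quot_alg pG -> quot_alg pH}, bijective f.
Proof.
move=> GH HG; have liftK (G1 H1 : B -> Prop) (p1 : ~ two_sided_ideal G1 1)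
    (p2 : ~ two_sided_ideal H1 1)
    (G1H1 : forall g, G1 g -> quot_proj p2 g = 0)
    (H1G1 : forall h, H1 h -> quot_proj p1 h = 0) :
  cancel (quot_lift (proper := p1) G1H1) (quot_lift (proper := p2) H1G1).
  by elim/quot_projW=> x; rewrite !quot_lift_proj.
exists (quot_lift (proper := pG) GH).
exact: Bijective (liftK _ _ _ _ GH HG) (liftK _ _ _ _ HG GH).
Qed.

(** * Pairs representing a trilinear operation, and the relations they satisfy *)

Section Representations.
Variables (F : fieldType) (B : algType F).
Implicit Types (u v x y z : B) (omega : trilinear_op F).

(** Taking all matrices as domain lets it apply to products in ['M_2] without carrying a proof that
    the diagonal is zero. *)
Definition antidiag_map u v (M : 'M[F]_2) : B := M 0 1 *: u + M 1 0 *: v.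

Fact antidiag_map_linear u v : linear (antidiag_map u v).
Proof.
move=> c M N; rewrite /antidiag_map !mxE !scalerDl -!scalerA scalerDr.
by rewrite addrACA.
Qed.
HB.instance Definition _ u v := GRing.isLinear.Build F 'M[F]_2 B *:%R
  (antidiag_map u v) (antidiag_map_linear u v).

(** The condition on the images of [gen_a] and [gen_b] for a morphism from the free algebra to
    factor through the envelope of [omega]. *)
Definition represents omega u v :=
  forall x y z : zdmx F,
    x \in [:: zd_e1 F; zd_e2 F] -> y \in [:: zd_e1 F; zd_e2 F] ->
    z \in [:: zd_e1 F; zd_e2 F] ->
    omega B (antidiag_map u v x) (antidiag_map u v y) (antidiag_map u v z)
    = antidiag_map u v (omega 'M[F]_2 x y z).

Definition triple_rel u v :=
  [/\ u * u = 0, v * v = 0, u * v * u = u & v * u * v = v].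

(** Of the eight cubic words in [u] and [v], only [u * v * u = u] and [v * u * v = v] survive. Their
    coefficients are the two off-diagonal entries of the matrix product. *)
Lemma antidiag_map_mul3 u v (x y z : zdmx F) : triple_rel u v ->
  antidiag_map u v x * antidiag_map u v y * antidiag_map u v z
  = antidiag_map u v ((x : 'M_2) * (y : 'M_2) * (z : 'M_2)).
Proof.
case=> uu vv uvu vuv; rewrite /antidiag_map.
have diag0 (w : zdmx F) i : (w : 'M_2) i i = 0.
  by have /forallP/(_ i)/eqP := zdmxP w.
rewrite !(mulrDl, mulrDr) -!(scalerAl, scalerAr) uu vv uvu vuv.
rewrite -[u * v * v]mulrA -[v * u * u]mulrA uu vv !(mul0r, mulr0, scaler0).
rewrite !mxE !big_ord_recl !big_ord0.
rewrite !mxE !big_ord_recl !big_ord0 /=.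
have -> : lift ord0 ord0 = 1 :> 'I_2 by apply: val_inj.
rewrite -[ord0]/(0 : 'I_2) !diag0.
rewrite !(mulr0, mul0r, addr0, add0r, scalerA).
by congr (_ *: _ + _ *: _); rewrite [RHS]mulrC mulrA.
Qed.

Lemma triple_rel_represents omega u v : triple_rel u v -> represents omega u v.
Proof.
move=> uv x y z _ _ _; have [c1 [c2 [c3 [c4 [c5 [c6 E]]]]]] := triopP omega.
by rewrite !E !linearD !linearZ /= !antidiag_map_mul3.
Qed.

Lemma natr_mul_eq0 n x : n%:R != 0 :> F -> x *+ n = 0 -> x = 0.
Proof.
by move=> n0 /eqP; rewrite -scaler_nat scaler_eq0 (negbTE n0) => /eqP.
Qed.

Lemma natr_mul_inj n x y : n%:R != 0 :> F -> x *+ n = y *+ n -> x = y.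
Proof.
by move=> n0 xy; apply/subr0_eq/(natr_mul_eq0 n0); rewrite mulrnBl xy subrr.
Qed.

Lemma jordan_infty_sandwich u v : 2%:R != 0 :> F ->
    jordan_infty_fun u u u = 0 -> jordan_infty_fun u v u = u *+ 2 ->
    jordan_infty_fun u u v = 0 ->
  u * u = 0 /\ u * v * u = u.
Proof.
rewrite /jordan_infty_fun -!mulr2n => two0.
move=> /(natr_mul_eq0 two0) u3 /(natr_mul_inj two0) uvu uuv.
(* After right multiplication by [u], the first term is [u * (u * v * u) = u * u] and the second
   ends in [u * u * u = 0]. *)
split=> //; move/(congr1 ( *%R^~ u)): uuv.
rewrite mul0r mulrDl -[u * u * v]mulrA -mulrA uvu.
by rewrite -!mulrA [u * (u * u)]mulrA u3 mulr0 addr0.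
Qed.

(** Doubling clears the factor 1/2 of [jordan_prod], leaving only natural multiples of words. *)
Lemma jordan_half_double x y z : 2%:R != 0 :> F ->
  jordan_half_fun x y z *+ 2
  = x * y * z + z * y * x + (x * z * y + z * x * y) *+ 2.
Proof.
move=> two0; rewrite /jordan_half_fun /jordan_prod -!scalerAr -!scalerAl.
rewrite -!scalerDr -scaler_nat scalerA mulfV // scale1r mulr2n.
rewrite !mulrDl !mulrDr !mulrA -!addrA; congr (_ + _).
rewrite [RHS]addrCA; congr (_ + _); rewrite [RHS]addrCA.
by congr (_ + (_ + _)); rewrite addrC.
Qed.

Lemma jordan_half_sandwich u v : 2%:R != 0 :> F -> 3%:R != 0 :> F ->
    jordan_half_fun u u u = 0 -> jordan_half_fun u v u = u ->
    jordan_half_fun u u v = u ->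
  u * u = 0 /\ u * v * u = u.
Proof.
move=> two0 three0.
have double x y z w : jordan_half_fun x y z = w ->
  x * y * z + z * y * x + (x * z * y + z * x * y) *+ 2 = w *+ 2.
  by move=> <-; rewrite jordan_half_double.
move=> /double u3 /double uvu /double uuv.
(* All words coincide here, so the doubled identity reads 6 u^3 = 0. *)
have {}u3 : u * u * u = 0.
  apply: (natr_mul_eq0 two0); apply: (natr_mul_eq0 three0).
  by move: u3; rewrite mul0rn -mulr2n -mulrS.
have {}uvu : u * v * u + u * u * v *+ 2 = u.
  by apply: (natr_mul_inj two0); rewrite -uvu -!mulr2n mulrnDl.
(* Multiply [uvu] by [u] on the left; the term in u^3 vanishes. *)
have uuvu : u * u * v * u = u * u.
  by rewrite -{5}uvu mulrDr mulrnAr !mulrA u3 mul0r mul0rn addr0.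
have uvuu : u * v * u * u + u * u *+ 2 = u * u.
  by rewrite -{6}uvu mulrDl mulrnAl uuvu.
have uvuu2 : u * v * u * u *+ 2 + u * u = u * u *+ 2.
  move/(congr1 ( *%R^~ u)): uuv; rewrite !(mulrDl, mulrnAl) uuvu.
  have -> : v * u * u * u = 0 by rewrite -[v * u * u]mulrA -mulrA u3 mulr0.
  by rewrite !addr0 addrC.
have uu : u * u = 0.
  (* Twice [uvuu] gives 2 uvu^2 + 4 u^2 = 2 u^2, while [uvuu2] gives 2 uvu^2 + u^2 = 2 u^2; the left
     sides differ by 3 u^2. *)
  apply: (natr_mul_eq0 three0); apply: (addrI (u * v * u * u *+ 2 + u * u)).
  by rewrite -addrA -mulrS (mulrnA _ 2 2) -mulrnDl uvuu uvuu2 addr0.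
by split=> //; rewrite -{3}uvu uu mul0r mul0rn addr0.
Qed.

Lemma triple_relC u v : triple_rel u v -> triple_rel v u.
Proof. by case=> *; split. Qed.

(** Applied to the matrix units, this supplies the right-hand sides of the hypotheses of
    [jordan_infty_sandwich]. *)
Lemma jordan_infty_values u v : triple_rel u v ->
  [/\ jordan_infty_fun u u u = 0, jordan_infty_fun u v u = u *+ 2 &
      jordan_infty_fun u u v = 0].
Proof.
case=> uu _ uvu _; rewrite /jordan_infty_fun uvu -[v * u * u]mulrA uu.
by rewrite !(mul0r, mulr0) !addr0.
Qed.

Lemma jordan_half_values u v : 2%:R != 0 :> F -> triple_rel u v ->
  [/\ jordan_half_fun u u u = 0, jordan_half_fun u v u = u &
      jordan_half_fun u u v = u].
Proof.
move=> two0 [uu _ uvu _].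
split; apply: (natr_mul_inj two0); rewrite jordan_half_double //.
- by rewrite uu !(mul0r, addr0, mul0rn).
- by rewrite uvu uu !(mul0r, addr0, mul0rn).
- by rewrite uvu -[v * u * u]mulrA uu !(mul0r, mulr0, addr0, add0r).
Qed.

End Representations.

(** * Representing pairs and morphisms out of the envelopes *)

Section EnvelopeRepresentations.
Variable F : fieldType.
Implicit Types (B : algType F) (omega : trilinear_op F).

Lemma zd_triple_rel : triple_rel (zd_e1 F : 'M_2) (zd_e2 F : 'M_2).
Proof. by split; rewrite /= /GRing.mul /= !mul_delta_mx_cond ?mulr0n. Qed.

Lemma antidiag_map_e1 B (u v : B) : antidiag_map u v (zd_e1 F) = u.
Proof. by rewrite /antidiag_map !mxE /= scale1r scale0r addr0. Qed.

Lemma antidiag_map_e2 B (u v : B) : antidiag_map u v (zd_e2 F) = v.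
Proof. by rewrite /antidiag_map !mxE /= scale1r scale0r add0r. Qed.

(** The triples 111, 121 and 112 of basis indices give the relations for [u]; exchanging 1 and 2
    gives those for [v]. *)
Lemma jordan_infty_triple_rel B (u v : B) : 2%:R != 0 :> F ->
  represents (jordan_infty F) u v -> triple_rel u v.
Proof.
move=> two0 rep; have mx12 := zd_triple_rel.
have e1 : zd_e1 F \in [:: zd_e1 F; zd_e2 F] by rewrite mem_head.
have e2 : zd_e2 F \in [:: zd_e1 F; zd_e2 F] by rewrite !inE eqxx orbT.
have [m111 m121 m112] := jordan_infty_values mx12.
have [m222 m212 m221] := jordan_infty_values (triple_relC mx12).
have mapE := (antidiag_map_e1, antidiag_map_e2, linear0).
have [||| uu uvu] := @jordan_infty_sandwich F B u v two0.
- by have := rep _ _ _ e1 e1 e1; rewrite /= m111 !mapE.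
- by have := rep _ _ _ e1 e2 e1; rewrite /= m121 linearMn /= !mapE.
- by have := rep _ _ _ e1 e1 e2; rewrite /= m112 !mapE.
have [||| vv vuv] := @jordan_infty_sandwich F B v u two0.
- by have := rep _ _ _ e2 e2 e2; rewrite /= m222 !mapE.
- by have := rep _ _ _ e2 e1 e2; rewrite /= m212 linearMn /= !mapE.
- by have := rep _ _ _ e2 e2 e1; rewrite /= m221 !mapE.
by split.
Qed.

Lemma jordan_half_triple_rel B (u v : B) : 2%:R != 0 :> F -> 3%:R != 0 :> F ->
  represents (jordan_half F) u v -> triple_rel u v.
Proof.
move=> two0 three0 rep; have mx12 := zd_triple_rel.
have e1 : zd_e1 F \in [:: zd_e1 F; zd_e2 F] by rewrite mem_head.
have e2 : zd_e2 F \in [:: zd_e1 F; zd_e2 F] by rewrite !inE eqxx orbT.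
have [m111 m121 m112] := jordan_half_values two0 mx12.
have [m222 m212 m221] := jordan_half_values two0 (triple_relC mx12).
have mapE := (antidiag_map_e1, antidiag_map_e2, linear0).
have [||| uu uvu] := @jordan_half_sandwich F B u v two0 three0.
- by have := rep _ _ _ e1 e1 e1; rewrite /= m111 !mapE.
- by have := rep _ _ _ e1 e2 e1; rewrite /= m121 !mapE.
- by have := rep _ _ _ e1 e1 e2; rewrite /= m112 !mapE.
have [||| vv vuv] := @jordan_half_sandwich F B v u two0 three0.
- by have := rep _ _ _ e2 e2 e2; rewrite /= m222 !mapE.
- by have := rep _ _ _ e2 e1 e2; rewrite /= m212 !mapE.
- by have := rep _ _ _ e2 e2 e1; rewrite /= m221 !mapE.
by split.
Qed.

(** [f] commutes with [omega], a fixed combination of products, and [f] after [zd_phi] is the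
    [antidiag_map] of the images of the generators. *)
Lemma envelope_rel_represents omega B (f : {lrmorphism free_alg F -> B}) :
  (forall r, envelope_rel omega r -> f r = 0) <->
  represents omega (f (gen_a F)) (f (gen_b F)).
Proof.
have fphi x : f (zd_phi x) = antidiag_map (f (gen_a F)) (f (gen_b F)) x.
  by rewrite /zd_phi raddfD /= !linearZ.
have frel x y z :
    f (omega _ (zd_phi x) (zd_phi y) (zd_phi z) - zd_phi (zd_triop omega x y z))
    = omega B (antidiag_map (f (gen_a F)) (f (gen_b F)) x)
              (antidiag_map (f (gen_a F)) (f (gen_b F)) y)
              (antidiag_map (f (gen_a F)) (f (gen_b F)) z)
      - antidiag_map (f (gen_a F)) (f (gen_b F)) (omega 'M[F]_2 x y z).
  by rewrite raddfB /= triop_morph !fphi.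
split=> [f0 x y z ex ey ez|rep r [x [y [z [ex ey ez ->]]]]].
  by apply/subr0_eq; rewrite -frel; apply: f0; exists x, y, z.
by rewrite frel rep ?subrr.
Qed.

End EnvelopeRepresentations.

Theorem theorem5p3 (F : fieldType) (charF0 : [pchar F] =i pred0) :
  exists f : {lrmorphism envelope (jordan_half F) -> envelope (jordan_infty F)},
    bijective f.
Proof.
have natr0 n : n.+1%:R != 0 :> F by have /pcharf0P -> := charF0.
(* The generator classes represent [omega] in its own envelope, since the projection kills the
   defining relations. *)
have proj_rep omega : represents omega
    (quot_proj (@envelope_proper F omega) (gen_a F))
    (quot_proj (@envelope_proper F omega) (gen_b F)).
  apply/(envelope_rel_represents omega (quot_proj _)) => r rel.
  exact/quot_proj_eq0/TsiGen.
(* In each target envelope the generator classes satisfy [triple_rel], hence also represent the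
   operation of the source. *)
apply: quot_alg_iso => r; apply/(envelope_rel_represents _ (quot_proj _)) : r.
  exact/triple_rel_represents/jordan_infty_triple_rel.
exact/triple_rel_represents/jordan_half_triple_rel.
Qed.
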